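(* Let $(\alpha,\beta)$ be a pair of real-valued random variables such that $\mathbb{P}(|\alpha|\ne 1)>0$ and $\mathbb{E}\{\ln|\alpha|\}=0$. If $y:\mathbb{R}\to\mathbb{R}$ is a bounded function which is uniformly continuous on $\mathbb{R}$ and satisfies $$y(x)=\mathbb{E}\{y(\alpha(x-\beta))\}\qquad\text{for all } x\in\mathbb{R},$$ then $y$ is constant.
   Context: $\mathbb{E}$ denotes expectation with respect to the joint distribution of $(\alpha,\beta)$, which is an arbitrary probability measure on $\mathbb{R}^2$ subject to the stated hypotheses; no moment or independence assumption is made on $\beta$. The condition $\mathbb{E}\{\ln|\alpha|\}=0$ means that $\ln|\alpha|$ is integrable with mean zero (in particular $\alpha\neq0$ almost surely). *)

(* Defs.v *)
From mathcomp Require Export all_boot all_order all_algebra.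
From mathcomp Require Export all_classical all_reals all_analysis.
Export Order.TTheory GRing.Theory Num.Theory.
Export numFieldNormedType.Exports.

Set Implicit Arguments.
Unset Strict Implicit.
Unset Printing Implicit Defensive.

(* The logarithm is the extended-valued [lne], with [lne 0 = -oo]: with the
   real-valued [ln], for which [ln 0 = 0], the integrability of ln|alpha| would
   not exclude that alpha vanishes with positive probability. *)
Definition ln_abs (R : realType) (T : Type) (X : T -> R) : T -> \bar R :=
  fun t => lne (`|X t|%R)%:E.

(* Main.v *)
Require Import Defs.
From mathcomp Require Import measurable_realfun.
From mathcomp Require Import ring lra.

(* With omega the modulus of continuity of y, the function g s = omega (e^s) is
   bounded and nondecreasing, tends to 0 at -oo, and satisfies
   g s <= E (g (s + xi)) for xi = ln|alpha|.  Let G be a (convex) primitive of g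
   and D s = E (G (s + xi) - G s).  Then D >= 0 by convexity and E xi = 0, D is
   nondecreasing because D' s = E (g (s + xi)) - g s >= 0, and D s -> 0 as
   s -> +oo because D s <= E (g (s + xi) * xi) -> g(+oo) * E xi = 0.
   Hence D = 0: the subgradient inequality G (s + xi) - G s >= g s * xi is
   almost surely an equality, so g is constant on [s, s + e] as soon as
   P (xi > e) > 0.
   Thus g is constant, hence 0. *)

Local Open Scope classical_set_scope.
Local Open Scope ring_scope.

Set Implicit Arguments.
Unset Strict Implicit.

(** * Measurability and integrability of bounded functions *)

Lemma measurable_fun_gt (R : realType) (d : measure_display)
    (T : measurableType d) (f : T -> R) (r : R) :
  measurable_fun setT f -> measurable [set t | r < f t].
Proof.
move=> mf; have := mf measurableT `]r, +oo[%classic (measurable_itv _).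
by rewrite setTI; congr measurable; apply/seteqP; split => t /=;
  rewrite in_itv /= andbT.
Qed.

Lemma measurable_fun_neq (R : realType) (d : measure_display)
    (T : measurableType d) (f : T -> R) (r : R) :
  measurable_fun setT f -> measurable [set t | f t <> r].
Proof.
move=> mf; rewrite (_ : mkset _ = ~` (f @^-1` [set r])); last by [].
by apply: measurableC; rewrite -[_ @^-1` _]setTI; apply: mf.
Qed.

Lemma bounded_integrable (R : realType) (d : measure_display)
    (T : measurableType d) (mu : {measure set T -> \bar R}) (A : set T)
    (f : T -> R) (C : R) :
  measurable A -> (mu A < +oo)%E -> measurable_fun A f ->
  (forall t, `|f t| <= C) -> mu.-integrable A (EFin \o f).
Proof.
move=> mA muA mf f_bnd; apply: measurable_bounded_integrable => //.
exists C; split => [|M CM t _ /=]; first exact: num_real.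
by rewrite (le_trans (f_bnd t)) // ltW.
Qed.

Lemma probability_lty (R : realType) (d : measure_display)
    (T : measurableType d) (P : probability T R) (A : set T) :
  measurable A -> (P A < +oo)%E.
Proof. by move=> mA; apply: le_lt_trans (probability_le1 _ mA) (ltry 1). Qed.

(** * Convex primitives and the subharmonic inequality *)

(** [G] is the oriented integral of [g] from 0. The two-sided bound, valid for either order of [s]
    and [t], replaces differentiability, which may fail where [g] jumps. *)
Lemma primitive_of_nondecreasing (R : realType) (g : R -> R) (C : R) :
  {homo g : s t / s <= t} -> (forall s, `|g s| <= C) ->
  exists G : R -> R, forall s t, g s * (t - s) <= G t - G s <= g t * (t - s).
Proof.
move=> g_nd g_bnd.
pose mu := @lebesgue_measure R.
have mg (A : set R) : measurable A -> measurable_fun A g.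
  by move=> mA; apply: nondecreasing_measurable.
have muE (a b : R) (x y : bool) : a <= b ->
    mu [set` Interval (BSide x a) (BSide y b)] = (b - a)%:E.
  rewrite le_eqVlt => /predU1P[->|ab].
    by rewrite /mu lebesgue_measure_itv /= lte_fin ltxx subrr.
  by rewrite /mu lebesgue_measure_itv /= lte_fin ab.
have mu_lty (a b : R) (x y : bool) : a <= b ->
    (mu [set` Interval (BSide x a) (BSide y b)] < +oo)%E.
  by move=> ab; rewrite muE // ltry.
(* The difference of indicators is 1 on [[0, s[] if [0 <= s] and -1 on [[s, 0[] if [s < 0], so
   integrating [F s] orients the integral without a case split. *)
pose F s u := g u * (\1_(`]-oo, s[ : set R) u - \1_(`]-oo, 0[ : set R) u).
have iF s : mu.-integrable setT (EFin \o F s).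
  pose B : set R := `[- `|s|, `|s|]%classic.
  apply: (@le_integrable _ _ _ mu setT measurableT (EFin \o F s)
    (fun u => C%:E * (\1_B u)%:E)%E) => //.
  - apply/measurable_EFinP; apply: measurable_funM; first exact: mg.
    by apply: measurable_funB; apply: measurable_indic.
  - move=> u _; rewrite /= lee_fin.
    have C0 := le_trans (normr_ge0 _) (g_bnd 0).
    rewrite /F !indicE !mem_setE /= !in_itv /= !normrM (ger0_norm C0).
    rewrite ler_pM //.
    have s1 := ler_norm s; have := ler_norm (- s); rewrite normrN => s2.
    case: (ltP u s) (ltP u 0) => us [] u0; rewrite ?subrr ?normr0 //.
      have -> : - `|s| <= u <= `|s| by apply/andP; split; lra.
      by rewrite subr0.
    have -> : - `|s| <= u <= `|s| by apply/andP; split; lra.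
    by rewrite sub0r normrN.
  - apply: integrableZl => //; rewrite /B.
    apply/integrableP; split; first by apply/measurable_EFinP/measurable_indic.
    under eq_integral do rewrite gee0_abs ?lee_fin //.
    rewrite integral_indic // setIT; apply: mu_lty; have := normr_ge0 s; lra.
pose G s := \int[mu]_u F s u.
have GB s t : s <= t -> g s * (t - s) <= G t - G s <= g t * (t - s).
  move=> st.
  have -> : G t - G s = \int[mu]_(u in `[s, t[) g u.
    rewrite -RintegralB // [RHS]Rintegral_mkcond; apply: eq_Rintegral => u _.
    rewrite /F -mulrBr patchE !indicE !mem_setE /= !in_itv /=.
    (* Off [[s, t[] the restricted integrand takes the default value [point], which is 0 in [R]. *)
    case: (ltP u s) => us; case: (ltP u t) => ut /=;
      rewrite ?(mulr1n, mulr0n) ?(erefl : point = 0 :> R).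
    - ring.
    - by have := lt_le_trans us st; rewrite ltNge ut.
    - ring.
    - ring.
  have ig : mu.-integrable `[s, t[ (EFin \o g).
    apply: (bounded_integrable (C := C)) => //; [exact: mu_lty|exact: mg].
  have ic r : mu.-integrable `[s, t[ (EFin \o cst r).
    by apply: (bounded_integrable (C := `|r|)) => //; apply: mu_lty.
  have cE r : r * (t - s) = \int[mu]_(u in `[s, t[) r.
    rewrite Rintegral_cst //; congr (_ * _).
    exact: (congr1 fine (esym (muE s t true true st))).
  rewrite !cE; apply/andP; split; apply: le_Rintegral => //; try exact: ic.
    by move=> u /=; rewrite in_itv /= => /andP[su _]; apply: g_nd.
  by move=> u /=; rewrite in_itv /= => /andP[_ ut]; apply/g_nd/ltW.
exists G => s t; have [st|/ltW ts] := leP s t; first exact: GB.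
by have := GB _ _ ts; lra.
Qed.

(** If no such [e] existed, [xi <= 0] would hold almost surely, and mean zero would then force
    [xi = 0] almost surely. *)
Lemma exists_pos_gap (R : realType) (d : measure_display)
    (T : measurableType d) (P : probability T R) (xi : T -> R) :
  P.-integrable setT (EFin \o xi) -> \int[P]_t xi t = 0 ->
  (0 < P [set t | (xi t <> 0)%R])%E ->
  exists2 e : R, 0 < e & (0 < P [set t | (e < xi t)%R])%E.
Proof.
move=> ixi xi0 Pxi.
have mxi : measurable_fun setT xi by apply/measurable_EFinP/(measurable_int P).
have m_gt e : measurable [set t | e < xi t].
  exact: measurable_fun_gt.
apply: contrapT => /forall2NP no_e.
have gt_null e : 0 < e -> P [set t | e < xi t] = 0%E.
  move=> e0; have [//|/negP] := no_e e.
  by rewrite lt0e measure_ge0 andbT negbK => /eqP.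
have neg_pos : P.-negligible [set t | 0 < xi t].
  have sub : [set t | 0 < xi t] `<=` \bigcup_k [set t | k.+1%:R^-1 < xi t].
    move=> t /= t0; exists (Num.bound (xi t)^-1) => //=.
    rewrite invf_plt ?posrE //.
    rewrite (lt_le_trans (archi_boundP _)) ?invr_ge0 ?ler_nat //; exact: ltW.
  apply: (negligibleS sub); apply: negligible_bigcup => k.
  by apply/negligibleP => //; apply: gt_null.
have ae_le : \forall t \ae P, xi t <= 0.
  by apply: negligibleS neg_pos => t /=; rewrite ltNge => /negP.
(* Almost surely [|xi| = - xi], so the integral of [|xi|] is minus the mean, that is 0. *)
have ae0 : ae_eq P setT (EFin \o xi) (cst 0%E).
  apply/ae_eq_integral_abs => //; first exact/measurable_EFinP.
  rewrite (@ae_eq_integral _ _ _ _ _ (fun t => - (xi t)%:E)%E) //.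
  - rewrite integralN /=; last exact: integrable_add_def.
    rewrite -[X in (- X)%E]fineK ?integrable_fin_num //.
    by move: xi0; rewrite /Rintegral => ->; rewrite oppe0.
  - by apply/measurable_EFinP/measurableT_comp.
  - exact/measurable_EFinP/measurable_funN.
  - by move: ae_le; apply: filterS => t /= xit _; rewrite ler0_norm.
move: Pxi; rewrite (_ : P _ = 0%E) ?ltxx //; apply/negligibleP.
  exact: measurable_fun_neq.
by apply: negligibleS ae0 => t /= nz; apply: contra_not nz => /(_ I)[].
Qed.

Lemma subharmonic_nondecreasing_cst (R : realType) (d : measure_display)
    (T : measurableType d) (P : probability T R) (xi : T -> R) (g : R -> R)
    (C : R) :
  P.-integrable setT (EFin \o xi) -> \int[P]_t xi t = 0 ->
  (0 < P [set t | (xi t <> 0)%R])%E ->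
  {homo g : s t / s <= t} -> (forall s, `|g s| <= C) ->
  (forall s, g s <= \int[P]_t g (s + xi t)) ->
  forall s t, g s = g t.
Proof.
move=> ixi xi0 /(exists_pos_gap ixi xi0)[e e0 Pe] g_nd g_bnd g_sub.
have mxi : measurable_fun setT xi by apply/measurable_EFinP/(measurable_int P).
have [G GP] := primitive_of_nondecreasing g_nd g_bnd.
have C0 : 0 <= C := le_trans (normr_ge0 _) (g_bnd 0).
have gC s : - C <= g s <= C by rewrite -ler_norml.
have mshift s : measurable_fun setT (fun t => s + xi t).
  exact: measurable_funD.
have mG : measurable_fun setT G.
  (* The slopes of [G] are at least [- C], so [G s + C * s] is nondecreasing, hence measurable. *)
  rewrite (_ : G = fun s => (G s + C * s) - C * s); last first.
    by apply/funext => s; ring.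
  apply: measurable_funB; last exact: measurable_funM.
  apply: nondecreasing_measurable => // s t st.
  have /andP[+ _] := GP s t; have /andP[+ _] := gC s; nra.
have ig s : P.-integrable setT (EFin \o (fun t => g (s + xi t))).
  apply: (bounded_integrable (C := C)) => //; first exact: probability_lty.
  by apply: measurableT_comp (mshift s); apply: nondecreasing_measurable.
have iC r : P.-integrable setT (EFin \o cst r).
  exact: finite_measure_integrable_cst.
have iZ r f : P.-integrable setT (EFin \o f) ->
    P.-integrable setT (EFin \o (fun t => r * f t)).
  by move=> fi; exact: (integrableZl measurableT r fi).
have iB f f' : P.-integrable setT (EFin \o f) ->
    P.-integrable setT (EFin \o f') ->
    P.-integrable setT (EFin \o (fun t => f t - f' t)).
  by move=> fi f1i; exact: (integrableB measurableT fi f1i).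
have intc r : \int[P]_t r = r.
  rewrite Rintegral_cst // -[RHS]mulr1; congr (_ * _).
  exact: (congr1 fine (probability_setT P)).
have iG s : P.-integrable setT (EFin \o (fun t => G (s + xi t) - G s)).
  apply: (@le_integrable _ _ _ P setT measurableT _
    (EFin \o (fun t => C * xi t))).
  - apply/measurable_EFinP; apply: measurable_funB => //.
    exact: measurableT_comp (mshift s).
  - move=> t _ /=; rewrite lee_fin normrM (ger0_norm C0).
    have := GP s (s + xi t); have := gC s; have := gC (s + xi t).
    move=> /andP[? ?] /andP[? ?] /andP[].
    rewrite (_ : s + xi t - s = xi t); last by ring.
    move=> ? ?; rewrite ler_norml.
    have [?|?] := leP 0 (xi t); last first.
      by rewrite ltr0_norm //; apply/andP; split; nra.
    by rewrite ger0_norm //; apply/andP; split; nra.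
  - exact: iZ.
pose D s := \int[P]_t (G (s + xi t) - G s).
have G_ge s t : 0 <= G (s + xi t) - G s - g s * xi t.
  by have /andP[+ _] := GP s (s + xi t);
    rewrite (_ : s + xi t - s = xi t); [lra|ring].
(* As [xi] has mean zero, subtracting [g s * xi t] leaves the integral unchanged and makes the
   integrand nonnegative. *)
have D_E s : \int[P]_t (G (s + xi t) - G s - g s * xi t) = D s.
  by rewrite RintegralB ?RintegralZl ?xi0 ?mulr0 ?subr0 //; apply: iZ.
have D_ge0 s : 0 <= D s.
  by rewrite -D_E; apply: Rintegral_ge0.
(* A discrete form of D' s = E (g (s + xi)) - g s >= 0, which avoids
   interchanging an integral with a derivative. *)
have D_step s h : 0 <= h -> h * (g s - g (s + h)) <= D (s + h) - D s.
  move=> h0; apply: (@le_trans _ _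
    (\int[P]_t (h * g (s + xi t) - h * g (s + h)))).
    rewrite RintegralB ?RintegralZl //; try exact: iC; try exact: iZ.
    by rewrite intc mulrBr lerB // ler_wpM2l.
  rewrite -RintegralB //; apply: le_Rintegral => //; [exact/iB/iC/iZ|exact: iB|].
  move=> t _.
  have /andP[+ _] := GP (s + xi t) (s + h + xi t).
  have /andP[_] := GP s (s + h).
  rewrite (_ : s + h + xi t - (s + xi t) = h); last by ring.
  by rewrite (_ : s + h - s = h); [lra|ring].
(* Adding up [n] consecutive steps of length [h], the values of [g] telescope. *)
have D_steps s h n : 0 <= h ->
    h * (g s - g (s + h *+ n)) <= D (s + h *+ n) - D s.
  move=> h0; elim: n => [|n IH]; first by rewrite mulr0n addr0 !subrr mulr0.
  have := D_step (s + h *+ n) h h0.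
  by rewrite -addrA -mulrSr; move: IH; lra.
have D_nd s t : s <= t -> D s <= D t.
  move=> st; rewrite leNgt; apply/negP => Dst.
  have Dpos : 0 < D s - D t by rewrite subr_gt0.
  (* With [n.+1] steps from [s] to [t], [D] drops by at most [2 * C * (t - s) / n.+1]; this [n]
     makes that smaller than the supposed drop [D s - D t]. *)
  set n := Num.bound (2 * C * (t - s) / (D s - D t)).
  have n_gt : 2 * C * (t - s) < n.+1%:R * (D s - D t).
    rewrite -ltr_pdivrMr //; apply: lt_le_trans (archi_boundP _) _.
      by rewrite divr_ge0 ?mulr_ge0 ?subr_ge0 // ltW.
    by rewrite ler_nat.
  have n0 : 0 < n.+1%:R :> R by rewrite ltr0n.
  set h := (t - s) / n.+1%:R.
  have h0 : 0 <= h by rewrite divr_ge0 ?subr_ge0 // ltW.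
  have hn : n.+1%:R * h = t - s by rewrite /h mulrC divfK // gt_eqF.
  have := D_steps s h n.+1 h0.
  rewrite -(mulr_natl h) hn (addrC s) subrK => step.
  have /andP[? ?] := gC s; have /andP[? ?] := gC t.
  have : n.+1%:R * (h * (g s - g t)) <= n.+1%:R * (D t - D s).
    by rewrite ler_pM2l.
  rewrite mulrA hn.
  have : (t - s) * (g s - g t) >= (t - s) * (- (2 * C)).
    by apply: ler_wpM2l; rewrite ?subr_ge0 //; lra.
  by move: n_gt; lra.
have igx s : P.-integrable setT (EFin \o (fun t => g (s + xi t) * xi t)).
  apply: (@le_integrable _ _ _ P setT measurableT _
    (EFin \o (fun t => C * xi t))).
  - apply/measurable_EFinP; apply: measurable_funM => //.
    by apply/measurable_EFinP/(measurable_int P).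
  - by move=> t _ /=; rewrite lee_fin !normrM (ger0_norm C0) ler_wpM2r.
  - exact: iZ.
have D_le s : D s <= \int[P]_t (g (s + xi t) * xi t).
  apply: le_Rintegral => // t _.
  by have /andP[_] := GP s (s + xi t);
    rewrite (_ : s + xi t - s = xi t); [|ring].
(* [L] is the supremum of [g], which by monotonicity is its limit at +oo. *)
have [L L_ub L_adh] : exists2 L, forall s, g s <= L &
    forall r, 0 < r -> exists u, L - r < g u.
  have ubg : has_ubound (range g).
    by exists C => _ [s _ <-]; have /andP[] := gC s.
  exists (sup (range g)) => [s|r r0]; first by apply: ub_le_sup => //; exists s.
  have supg : has_sup (range g) by split => //; exists (g 0), 0.
  by have [_ [u _ <-] ru] := sup_adherent r0 supg; exists u.
have cvg_g x : (fun n : nat => g (n%:R + x)) @ \oo --> L.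
  apply/cvgrPdist_le => r /L_adh[u ru].
  near=> n.
  have gu : g u <= g (n%:R + x).
    apply: g_nd; rewrite -lerBlDr; apply: le_trans (ler_norm _) _.
    by near: n; exact: nbhs_infty_ger.
  by rewrite ger0_norm ?subr_ge0 //; lra.
have cvg0 :
    (fun n : nat => \int[P]_t (g (n%:R + xi t) * xi t)) @ \oo --> (0 : R).
  (* The dominating function is [C * |xi|]; the limit [L * xi] has integral 0. *)
  have [] := @dominated_convergence _ _ _ P setT measurableT
    (fun n t => (g (n%:R + xi t) * xi t)%:E) (fun t => (L * xi t)%:E)
    (fun t => (C * `|xi t|)%:E).
  - by move=> n; apply: measurable_int (igx n%:R).
  - by apply: (measurable_int P); apply: iZ.
  - apply: nearW => t _; apply: cvg_EFin; first exact: nearW.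
    by apply: cvgMl; apply: cvg_g.
  - apply: iZ; exact: (integrable_norm ixi).
  - by apply: nearW => t n _ /=; rewrite lee_fin normrM ler_wpM2r.
  move=> _ _; rewrite (_ : (\int[P]_t _)%E = 0%:E); first exact: fine_cvg.
  rewrite -[LHS]fineK; last by apply: integrable_fin_num => //; apply: iZ.
  by congr EFin; rewrite -[LHS]/(\int[P]_t (L * xi t)) RintegralZl // xi0 mulr0.
have D0 s : D s = 0.
  apply/eqP; rewrite eq_le D_ge0 andbT.
  rewrite -[leRHS](cvg_lim (@Rhausdorff R) cvg0).
  apply: limr_ge; first exact: cvgP cvg0.
  near=> n; apply: le_trans (D_le n%:R); apply: D_nd.
  apply: le_trans (ler_norm _) _.
  by near: n; exact: nbhs_infty_ger.
have g_e s : g (s + e) = g s.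
  apply/eqP; rewrite eq_le andbC; apply/andP; split.
    by apply: g_nd; rewrite lerDl ltW.
  have iH : P.-integrable setT
      (EFin \o (fun t => G (s + xi t) - G s - g s * xi t)).
    by apply: iB => //; apply: iZ.
  have /ae_eq_integral_abs :
      (\int[P]_t `|(G (s + xi t) - G s - g s * xi t)%:E| = 0)%E.
    under eq_integral do rewrite gee0_abs ?lee_fin ?G_ge //.
    rewrite -[LHS]fineK; last by apply: integrable_fin_num => //.
    by congr EFin; rewrite -[RHS](D0 s) -D_E.
  move=> /(_ measurableT (measurable_int P iH)) ae0.
  (* Equality in the subgradient inequality holds almost surely and [e < xi] has positive
     probability, so some [t] satisfies both. *)
  have [t [et tE]] : exists t, e < xi t /\ G (s + xi t) - G s - g s * xi t = 0.
    apply: contrapT => /forallNP no_t.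
    move: Pe; rewrite (_ : P _ = 0%E) ?ltxx //; apply/negligibleP.
      exact: measurable_fun_gt.
    apply: negligibleS ae0 => t /= et /(_ I)[] tE.
    by apply: (no_t t).
  (* Bounding [G] below on the two pieces from [s] to [s + e] and from [s + e] to [s + xi t], and
     comparing with [tE], gives [g (s + e) * (xi t - e) <= g s * (xi t - e)]. *)
  have /andP[+ _] := GP s (s + e); have /andP[+ _] := GP (s + e) (s + xi t).
  rewrite (_ : s + e - s = e); last by ring.
  move=> G1 G2; rewrite -(@ler_pM2r _ (xi t - e)) ?subr_gt0 //.
  by move: G1 G2 tE; lra.
have g_en s n : g (s + e *+ n) = g s.
  by elim: n => [|n IH]; rewrite ?mulr0n ?addr0 // mulrSr addrA g_e.
have g_le s t : g t <= g s.
  (* The multiple of [e] is chosen so that the shifted point lies beyond [t]. *)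
  apply: (@le_trans _ _ (g (s + e *+ Num.bound (`|t - s| / e)))).
    2: by rewrite g_en.
  apply: g_nd; rewrite -lerBlDl; apply: le_trans (ler_norm _) _.
  rewrite -mulr_natl -ler_pdivrMr //; apply/ltW/archi_boundP.
  by rewrite divr_ge0 // ltW.
by move=> s t; apply/eqP; rewrite eq_le !g_le.
Unshelve. all: by end_near. Qed.

(** * The real logarithm of [|alpha|] and the modulus of continuity *)

(** An integrable function is finite almost everywhere, while [lne 0] is -oo; hence [alpha] vanishes
    only on a null set, off which both logarithms agree. *)
Lemma ln_abs_integrable (R : realType) (d : measure_display)
    (T : measurableType d) (P : probability T R) (alpha : {RV P >-> R}) :
  P.-integrable setT (ln_abs alpha) ->
  let xi t := ln `|alpha t| in
  [/\ P.-integrable setT (EFin \o xi),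
      ((\int[P]_t xi t)%:E = \int[P]_t ln_abs alpha t)%E &
      P.-negligible [set t | alpha t = 0] ].
Proof.
move=> ia xi.
have malpha : measurable_fun setT alpha by [].
have mxi : measurable_fun setT (EFin \o xi).
  apply/measurable_EFinP; apply: measurableT_comp; first exact: measurable_ln.
  exact: measurableT_comp.
have fin_ae := integrable_ae measurableT ia.
have alpha_ae : P.-negligible [set t | alpha t = 0].
  apply: negligibleS fin_ae => t /= a0 /(_ I).
  by rewrite /ln_abs a0 normr0 le0_lneNy.
have ln_ae : ae_eq P setT (ln_abs alpha) (EFin \o xi).
  apply: negligibleS alpha_ae => t /=; apply: contra_notP => a0 _.
  by rewrite /ln_abs lne_EFin // normr_gt0; apply/eqP.
have iE : (\int[P]_t ln_abs alpha t = \int[P]_t (xi t)%:E)%E.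
  by apply: ae_eq_integral => //; apply: measurable_int ia.
have ixi : P.-integrable setT (EFin \o xi).
  apply/integrableP; split => //.
  move/integrableP: ia => [mla].
  rewrite (@ae_eq_integral _ _ _ _ _ (fun t => `|(xi t)%:E|)%E) //.
  - exact: measurableT_comp.
  - exact: measurableT_comp.
  - by move: ln_ae; apply: filterS => t /[apply] ->.
by split => //; rewrite iE fineK ?integrable_fin_num.
Qed.

Lemma unif_continuous_dist (R : realType) (y : R -> R) : unif_continuous y ->
  forall e, 0 < e ->
  exists2 r, 0 < r & forall x x', `|x - x'| < r -> `|y x - y x'| < e.
Proof.
move=> y_uc e e0.
have : entourage [set xy : R * R | ball xy.1 e xy.2].
  by rewrite -entourage_ballE; exists e.
move=> /y_uc; rewrite /fmap /= /nbhs /= -entourage_ballE => -[r r0 yr].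
by exists r => // x x' xx'; apply: (yr (x, x')).
Qed.

(** The real [sup] is meaningful only for nonempty sets bounded above: [le_modulus] gets the upper
    bound from the bound on [y], [modulus_le] gets nonemptiness from [0 <= r]. *)
Definition modulus (R : realType) (y : R -> R) (r : R) : R :=
  sup [set `|y u.1 - y u.2| | u in [set u : R * R | `|u.1 - u.2| <= r]].

Lemma le_modulus (R : realType) (y : R -> R) (M r x x' : R) :
  (forall x, `|y x| <= M) -> `|x - x'| <= r -> `|y x - y x'| <= modulus y r.
Proof.
move=> y_bnd xx'; apply: ub_le_sup; last by exists (x, x').
exists (M + M) => _ [u _ <-].
by rewrite (le_trans (ler_normB _ _)) // lerD.
Qed.

Lemma modulus_le (R : realType) (y : R -> R) (r c : R) : 0 <= r ->
  (forall x x', `|x - x'| <= r -> `|y x - y x'| <= c) -> modulus y r <= c.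
Proof.
move=> r0 yc; apply: ge_sup; last by move=> _ [u ur <-]; apply: yc.
by exists `|y 0 - y 0|, (0, 0) => //=; rewrite subrr normr0.
Qed.

Unset Implicit Arguments.

(** * From the functional equation to constancy *)

Theorem theorem1p2 (R : realType) (d : measure_display) (T : measurableType d)
    (P : probability T R) (alpha beta : {RV P >-> R})
    (alpha_neq1 : (0 < P [set t | (`|alpha t| <> 1)%R])%E)
    (ln_alpha_integrable : P.-integrable setT (ln_abs alpha))
    (ln_alpha_mean0 : (\int[P]_t ln_abs alpha t = 0)%E)
    (y : R -> R)
    (y_bounded : bounded_fun y)
    (y_unif_continuous : unif_continuous y)
    (y_eq : forall x : R,
      (y x)%:E = ('E_P[fun t => y (alpha t * (x - beta t))%R])%E) :
  exists c : R, forall x : R, y x = c.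
Proof.
have malpha : measurable_fun setT alpha by [].
have mbeta : measurable_fun setT beta by [].
have [ixi xi0 alpha_ae] := ln_abs_integrable ln_alpha_integrable.
set xi := fun t => ln `|alpha t| in ixi xi0.
have {}xi0 : \int[P]_t xi t = 0.
  by apply: EFin_inj; rewrite xi0.
have mxi : measurable_fun setT xi by apply/measurable_EFinP/(measurable_int P).
have xi_neq0 : (0 < P [set t | (xi t <> 0)%R])%E.
  rewrite lt0e measure_ge0 andbT; apply/eqP => Pxi.
  have nxi := (negligibleP _ (measurable_fun_neq 0 mxi)).2 Pxi.
  move: alpha_neq1; rewrite (_ : P _ = 0%E) ?ltxx //; apply/negligibleP.
    exact/measurable_fun_neq/measurableT_comp.
  (* Since [ln 0 = 0], points with [alpha t = 0] have [xi t = 0] although [|alpha t| <> 1]; they are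
     absorbed by the null set [alpha_ae]. *)
  apply: negligibleS (negligibleU alpha_ae nxi) => t /= a1.
  have [->|a0] := eqVneq (alpha t) 0; first by left.
  right; apply: contra_not a1 => xit.
  by apply: ln_inj; rewrite ?posrE ?normr_gt0 // ln1.
have [M y_bnd] : exists M, forall x, `|y x| <= M.
  case: y_bounded => M0 [_ yM]; exists (M0 + 1) => x.
  by apply: yM; rewrite // ltrDl.
have my : measurable_fun setT y.
  apply: continuous_measurable_fun => x; apply/cvgrPdist_lt => e e0.
  have [r r0 yr] := unif_continuous_dist y_unif_continuous e0.
  near=> z; apply: yr; near: z.
  exact: cvgr_dist_lt.
pose Y x t := y (alpha t * (x - beta t)).
have iY x : P.-integrable setT (EFin \o Y x).
  apply: (bounded_integrable (C := M)) => //; first exact: probability_lty.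
  - apply: (measurableT_comp my); apply: measurable_funM => //.
    exact: measurable_funB.
  - by move=> t; apply: y_bnd.
have yE z : y z = \int[P]_t Y z t.
  by have := congr1 fine (y_eq z); rewrite unlock.
(* The exponential scale turns multiplication by [|alpha|] into translation by [xi]. *)
pose g s := modulus y (expR s).
have g0 s : 0 <= g s.
  apply: le_trans (le_modulus (x := 0) (x' := 0) y_bnd _);
    by rewrite ?subrr ?normr0 // expR_ge0.
have g_nd : {homo g : s t / s <= t}.
  move=> s t st; apply: modulus_le; first exact: expR_ge0.
  move=> x x' xx'; apply: (le_modulus y_bnd).
  by rewrite (le_trans xx') // ler_expR.
have gM s : `|g s| <= M + M.
  rewrite ger0_norm //; apply: modulus_le; first exact: expR_ge0.
  by move=> x x' _; rewrite (le_trans (ler_normB _ _)) // lerD.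
have g_sub s : g s <= \int[P]_t g (s + xi t).
  apply: modulus_le; first exact: expR_ge0.
  move=> x x' xx'; rewrite !yE -RintegralB //.
  have iYB : P.-integrable setT (EFin \o (fun t => Y x t - Y x' t)).
    exact: (integrableB measurableT (iY x) (iY x')).
  apply: le_trans (le_normr_Rintegral measurableT iYB) _.
  apply: le_Rintegral => //.
  - exact: (integrable_norm iYB).
  - apply: (bounded_integrable (C := M + M)) => //.
      exact: probability_lty.
    apply: (@measurableT_comp _ _ _ _ _ _ g); last exact: measurable_funD.
    exact: nondecreasing_measurable.
  (* [beta] cancels in the difference of the two arguments, leaving [alpha t * (x - x')], of size at
     most [expR (s + xi t)] when [alpha t] is nonzero. *)
  - move=> t _; rewrite /Y; have [->|at0] := eqVneq (alpha t) 0.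
      by rewrite !mul0r subrr normr0.
    apply: (le_modulus y_bnd).
    rewrite -mulrBr (_ : _ - _ = x - x'); last by ring.
    rewrite normrM expRD /xi lnK ?posrE ?normr_gt0 // mulrC.
    by rewrite ler_wpM2r.
have g_cst := subharmonic_nondecreasing_cst ixi xi0 xi_neq0 g_nd gM g_sub.
exists (y 0) => x; apply/eqP; rewrite -subr_eq0 -normr_le0.
apply/ler_addgt0Pr => e e0; rewrite add0r.
have [r r0 yr] := unif_continuous_dist y_unif_continuous e0.
(* The added 1 keeps the argument of [ln] positive even at [x = 0]. *)
apply: (@le_trans _ _ (g (ln (1 + `|x - 0|)))).
  by apply: (le_modulus y_bnd); rewrite lnK ?posrE ?lerDr // ltr_wpDr.
(* Constancy of [g] moves the bound to the small scale [r / 2], where uniform continuity applies;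
   halving turns [<=] into the strict [< r]. *)
rewrite (g_cst _ (ln (r / 2))).
have r2 : 0 < r / 2 by rewrite divr_gt0.
apply: modulus_le; first exact: expR_ge0.
move=> u v; rewrite lnK ?posrE // => uv; apply/ltW/yr.
by rewrite (le_lt_trans uv) // ltr_pdivrMr // ltr_pMr // ltr1n.
Unshelve. all: by end_near. Qed.
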